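(* Let $m,\ell,q$ be non-negative integers with $m+\ell=q$ and $\ell\ge 2$, let $a,b$ be complex numbers, and let $F(x)$ be the formal power series determined by $$F(x)=\frac{x^m}{1-ax^q-bx^\ell F(x)}.$$ Then for all integers $n\ge 0$, \begin{align*} H_{(\ell+m)n}(F)&=(-1)^{\binom{m+1}{2}n+\binom{\ell-1}{2}n}(a+b)^{\frac{(\ell+m)(n-1)n}{2}+(\ell-1)n}\,b^{\frac{(\ell+m)(n-1)n}{2}},\\ H_{(\ell+m)n+m+1}(F)&=(-1)^{\binom{m+1}{2}(n+1)+\binom{\ell-1}{2}n}(a+b)^{\frac{(\ell+m)(n+1)n}{2}}\,b^{\frac{(\ell+m)(n+1)n}{2}-(\ell-1)n}, \end{align*} and $H_N(F)=0$ for every non-negative integer $N$ that is not of the form $(\ell+m)n$ or $(\ell+m)n+m+1$ with $n\ge 0$.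
   Context: For a formal power series $A(x)=\sum_{n\ge 0}a_nx^n$, the Hankel determinant is $H_N(A)=\det(a_{i+j})_{0\le i,j\le N-1}$ for $N\ge 1$, and $H_0(A)=1$ by convention. Powers use the convention $0^0=1$. *)

(* Defs.v *)
From HB Require Import structures.
From mathcomp Require Import all_boot all_order all_algebra.
From mathcomp Require Import boolp reals.
From mathcomp Require Import complex.

Set Implicit Arguments.
Unset Strict Implicit.
Unset Printing Implicit Defensive.

Import GRing.Theory.
Local Open Scope ring_scope.

(* The wrapper prevents the pointwise ring structure on functions from being
   inferred. *)
Record fps (K : Type) := Fps { fps_coef :> nat -> K }.

HB.instance Definition _ (K : Type) := gen_eqMixin (fps K).
HB.instance Definition _ (K : Type) := gen_choiceMixin (fps K).

Section FormalPowerSeries.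
Variable K : fieldType.
Implicit Types f g h : fps K.

Lemma fpsP f g : (forall n, f n = g n) <-> f = g.
Proof.
split=> [|-> //]; case: f g => [f] [g] /= fg.
by congr Fps; apply: funext.
Qed.

Definition fpsC (c : K) : fps K := Fps (fun n => if n == 0%N then c else 0).
Definition fpsX : fps K := Fps (fun n => (n == 1%N)%:R).
Definition fps_opp f : fps K := Fps (fun n => - f n).
Definition fps_add f g : fps K := Fps (fun n => f n + g n).
Definition fps_mul f g : fps K :=
  Fps (fun n => \sum_(i < n.+1) f i * g (n - i)%N).

Fact fps_addA : associative fps_add.
Proof. by move=> f g h; apply/fpsP => n /=; rewrite addrA. Qed.
Fact fps_addC : commutative fps_add.
Proof. by move=> f g; apply/fpsP => n /=; rewrite addrC. Qed.
Fact fps_add0 : left_id (fpsC 0) fps_add.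
Proof. by move=> f; apply/fpsP => n /=; rewrite if_same add0r. Qed.
Fact fps_addN : left_inverse (fpsC 0) fps_opp fps_add.
Proof. by move=> f; apply/fpsP => n /=; rewrite if_same addNr. Qed.

HB.instance Definition _ :=
  GRing.isZmodule.Build (fps K) fps_addA fps_addC fps_add0 fps_addN.

Fact fps_mulC : commutative fps_mul.
Proof.
move=> f g; apply/fpsP => n /=; rewrite (reindex_inj rev_ord_inj) /=.
apply: eq_bigr => i _; rewrite subSS mulrC; congr (_ * _).
by rewrite subKn // -ltnS.
Qed.

Fact fps_mulA : associative fps_mul.
Proof.
move=> f g h; apply/fpsP => n; rewrite (fps_mulC (fps_mul f g) h) /=.
pose coef3 j k := f j * (g (n - j - k)%N * h k).
transitivity (\sum_(j < n.+1) \sum_(k < n.+1 | (k <= n - j)%N) coef3 j k).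
  apply: eq_bigr => /= j _.
  have -> : \sum_(k < (n - j).+1) g k * h (n - j - k)%N
          = (fps_mul h g) (n - j)%N by rewrite fps_mulC.
  rewrite /= big_distrr /= (big_ord_narrow_leq (leq_subr _ _)) /coef3.
  by apply: eq_bigr => k _ /=; rewrite (mulrC (h k)).
rewrite (exchange_big_dep predT) //=; apply: eq_bigr => k _.
transitivity (\sum_(j < n.+1 | (j <= n - k)%N) coef3 j k).
  apply: eq_bigl => j; rewrite -ltnS -(ltnS j) -!subSn ?leq_ord //.
  by rewrite -subn_gt0 -(subn_gt0 j) -!subnDA addnC.
rewrite (big_ord_narrow_leq (leq_subr _ _)) big_distrr /=.
by apply: eq_bigr => j _; rewrite /coef3 -!subnDA addnC mulrA mulrC.
Qed.

Fact fps_mul1 : left_id (fpsC 1) fps_mul.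
Proof.
move=> f; apply/fpsP => n /=; rewrite big_ord_recl /= mul1r subn0.
by rewrite big1 ?addr0 // => i _; rewrite mul0r.
Qed.

Fact fps_mulDl : left_distributive fps_mul fps_add.
Proof.
move=> f g h; apply/fpsP => n /=; rewrite -big_split /=.
by apply: eq_bigr => i _; rewrite mulrDl.
Qed.

Fact fps_1neq0 : fpsC 1 != 0.
Proof. by apply/eqP => /fpsP /(_ 0%N) /eqP /=; rewrite oner_eq0. Qed.

HB.instance Definition _ := GRing.Zmodule_isComNzRing.Build (fps K)
  fps_mulA fps_mulC fps_mul1 fps_mulDl fps_1neq0.

(* As everywhere in the ring hierarchy, the inverse of a non-unit is itself. *)
Definition fps_unit : {pred fps K} := fun f => `[< exists g, g * f = 1 >].
Definition fps_inv f : fps K :=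
  if pselect (exists g, g * f = 1) is left ex then projT1 (cid ex) else f.

Fact fps_mulVr : {in fps_unit, left_inverse 1 fps_inv *%R}.
Proof.
by move=> f /asboolP fU; rewrite /fps_inv; case: pselect => // ex; case: cid.
Qed.
Fact fps_unitP f g : g * f = 1 -> fps_unit f.
Proof. by move=> gf1; apply/asboolP; exists g. Qed.
Fact fps_inv_out : {in [predC fps_unit], fps_inv =1 id}.
Proof.
by move=> f /asboolP fNU; rewrite /fps_inv; case: pselect => // /fNU.
Qed.

HB.instance Definition _ := GRing.ComNzRing_hasMulInverse.Build (fps K)
  fps_mulVr fps_unitP fps_inv_out.

Lemma fps_mulE f g n : (f * g) n = \sum_(i < n.+1) f i * g (n - i)%N.
Proof. by []. Qed.

Lemma fps_strong_rec (Phi : fps K -> nat -> K) :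
  (forall f g n, (forall i, (i < n)%N -> f i = g i) -> Phi f n = Phi g n) ->
  exists f, forall n, f n = Phi f n.
Proof.
move=> PhiE; pose step f := Fps (Phi f).
pose it n := iter n step (0 : fps K).
have itE : forall n k i, (i < n)%N -> it n i = it (n + k)%N i.
  elim=> [//|n IHn] k i ltin; rewrite addSn /it !iterS /=; apply: PhiE => j ltj.
  by apply: IHn; apply: leq_trans ltj _.
exists (Fps (fun n => it n.+1 n)) => n /=.
apply: PhiE => i ltin; have := itE i.+1 (n - i.+1)%N i (leqnn _).
by rewrite subnKC.
Qed.

Lemma fps_unitE f : (f \is a GRing.unit) = (f 0%N != 0).
Proof.
apply/idP/idP => [fU|f0].
  apply/eqP => f0; have /fpsP /(_ 0%N) := mulVr fU.
  by rewrite fps_mulE big_ord1 /= subn0 f0 mulr0 => /esym/eqP; rewrite oner_eq0.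
pose Phi (g : fps K) n :=
  ((n == 0%N)%:R - \sum_(i < n) g i * f (n - i)%N) / f 0%N.
have [|g gE] := @fps_strong_rec Phi.
  move=> g h n gh; congr ((_ - _) / _); apply: eq_bigr => i _.
  by rewrite gh.
apply/unitrPr; exists g; rewrite mulrC; apply/fpsP => n.
rewrite fps_mulE big_ord_recr /= subnn gE /Phi divfK // addrC subrK.
by case: n.
Qed.

Lemma fps_mul_coef0 f g : (f * g) 0%N = f 0%N * g 0%N.
Proof. by rewrite fps_mulE big_ord1. Qed.

Lemma fps_mul_local h f g n : h 0%N = 0 ->
  (forall i, (i < n)%N -> f i = g i) -> (h * f) n = (h * g) n.
Proof.
move=> h0 fg; rewrite !fps_mulE !big_ord_recl h0 !mul0r; congr (_ + _).
by apply: eq_bigr => i _; rewrite fg // lift0 ltn_subrL /= (leq_trans _ (ltn_ord i)).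
Qed.

Lemma fps_mulX_coef0 f k : (0 < k)%N -> (f * fpsX ^+ k) 0%N = 0.
Proof.
by case: k => // k _; rewrite exprS !fps_mul_coef0 /= mul0r mulr0.
Qed.

(* By this lemma, the quotient in the next one is never by a non-unit. *)
Lemma fps_denom_unit (l q : nat) (a b : K) f : (0 < l)%N -> (0 < q)%N ->
  1 - fpsC a * fpsX ^+ q - fpsC b * fpsX ^+ l * f \is a GRing.unit.
Proof.
move=> l0 q0; rewrite fps_unitE.
have -> : (1 - fpsC a * fpsX ^+ q - fpsC b * fpsX ^+ l * f) 0%N
  = 1 - (fpsC a * fpsX ^+ q) 0%N - (fpsC b * fpsX ^+ l * f) 0%N by [].
by rewrite fps_mulX_coef0 // fps_mul_coef0 fps_mulX_coef0 // mul0r !subr0 oner_neq0.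
Qed.

Lemma fps_eq_unique (m l q : nat) (a b : K) : (0 < l)%N -> (0 < q)%N ->
  exists! f, f = fpsX ^+ m / (1 - fpsC a * fpsX ^+ q - fpsC b * fpsX ^+ l * f).
Proof.
move=> l0 q0.
pose u := fpsC a * fpsX ^+ q; pose v := fpsC b * fpsX ^+ l.
have u0 : u 0%N = 0 by apply: fps_mulX_coef0.
have v0 : v 0%N = 0 by apply: fps_mulX_coef0.
pose Phi f n := (fpsX ^+ m : fps K) n + (u * f) n + (v * (f * f)) n.
have PhiE f g n : (forall i, (i < n)%N -> f i = g i) -> Phi f n = Phi g n.
  move=> fg; congr (_ + _ + _); first exact: fps_mul_local.
  apply: fps_mul_local => // i ltin; rewrite !fps_mulE; apply: eq_bigr => j _.
  rewrite !fg //; first by apply: leq_ltn_trans ltin; rewrite leq_subr.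
  by apply: leq_ltn_trans ltin; rewrite -ltnS.
have eqE f : f = fpsX ^+ m / (1 - u - v * f) <-> forall n, f n = Phi f n.
  have fU := fps_denom_unit a b f l0 q0; rewrite -/u -/v in fU.
  have -> : (forall n, f n = Phi f n) <-> f = fpsX ^+ m + u * f + v * (f * f).
    exact: (fpsP f (fpsX ^+ m + u * f + v * (f * f))).
  have -> : (f = fpsX ^+ m / (1 - u - v * f)) <-> (f * (1 - u - v * f) = fpsX ^+ m).
    by split=> [{1}->|<-]; rewrite ?divrK ?mulrK.
  rewrite !mulrBr mulr1 (mulrC f u) (mulrCA f v).
  split=> [<-|{1}->]; first by rewrite addrAC !subrK.
  by rewrite addrAC !addrK.
have [f fE] := fps_strong_rec PhiE.
exists f; split=> [|g /eqE gE]; first exact/eqE.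
apply/fpsP => n; elim/ltn_ind: n => n IHn.
by rewrite fE gE; apply: PhiE.
Qed.

Definition hankel (A : fps K) (N : nat) : K :=
  \det (\matrix_(i < N, j < N) A (i + j)%N).

Lemma hankel0 (A : fps K) : hankel A 0 = 1.
Proof. exact: det_mx00. Qed.

End FormalPowerSeries.

Arguments fpsX {K}.

(* Main.v *)
Require Import Defs.
From mathcomp Require Import all_boot all_order all_algebra.
From mathcomp Require Import boolp reals.
From mathcomp Require Import complex.
From mathcomp Require Import ring zify.

Set Implicit Arguments.
Unset Strict Implicit.
Unset Printing Implicit Defensive.

Import GRing.Theory.
Local Open Scope ring_scope.

(** One step of a continued fraction strips a block off a Hankel determinant:
    if W = x^k / (1 - x^(k+2) V), then H_(k+1+M)(W) = (-1)^C(k+1,2) H_M(V)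
    ([hankel_quotient]), while H_N(W) = 0 for 0 < N <= k because W starts at
    x^k ([hankel_eq0]).

    The series F returns to a multiple of itself after two such steps.  Write
    F = x^m G.  The defining equation becomes G (1 - x^q g) = 1 with
    g = a + b G, that is F = x^m / (1 - x^(m+2) x^(l-2) g).  Moreover
      g (1 - b x^q G) = a + b G - b (x^q g G) = a + b G - b (G - 1) = a + b,
    so x^(l-2) g = (a + b) W, where
    W = x^(l-2) / (1 - b x^q G) = x^(l-2) / (1 - x^l b F).
    Since scaling a series by c multiplies H_N by c^N, the two steps give
      H_(q+N)(F) = (-1)^(C(m+1,2) + C(l-1,2)) (a+b)^(l-1+N) b^N H_N(F)
    ([hankel_periodD]).  As g is written as a + b times a series and never
    divided by a + b, the degenerate cases a + b = 0 and b = 0 need no separate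
    treatment.  The theorem follows by induction from the values of H_N(F) for
    N < q: these vanish except at N = 0 and at N = m + 1. *)

(** * Hankel determinants of a quotient *)

Section HankelReduction.
Variable K : fieldType.
Implicit Types A V W u : fps K.

Definition antidiag_mx k : 'M[K]_k.+1 := \matrix_(i, j) ((i + j)%N == k)%:R.

Lemma det_antidiag k : \det (antidiag_mx k) = (-1) ^+ 'C(k.+1, 2).
Proof.
elim: k => [|k IHk]; first by rewrite det_mx11 mxE.
rewrite (expand_det_row _ ord0) (bigD1 ord_max) //= big1 => [|j jmax];
  last first.
  rewrite mxE [(_ == _)](_ : _ = false) ?mul0r //.
  by apply: contraNF jmax => /eqP jE; apply/eqP/val_inj.
rewrite mxE /= add0n eqxx mul1r addr0 /cofactor /= add0n.
have -> : row' ord0 (col' ord_max (antidiag_mx k.+1)) = antidiag_mx k.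
  apply/matrixP => i j; rewrite !mxE lift0 lift_max addSn eqSS.
  by congr (_%:R).
by rewrite IHk -exprD [in RHS]binS bin1 addnC.
Qed.

Definition toeplitz u N : 'M[K]_N :=
  \matrix_(i, j) if (j <= i)%N then u (i - j)%N else 0.

Lemma det_toeplitz u N : u 0%N = 1 -> \det (toeplitz u N) = 1.
Proof.
move=> u0; rewrite det_trig => [|]; last first.
  by apply/is_trig_mxP => i j ltij; rewrite mxE leqNgt ltij.
by apply: big1 => i _; rewrite mxE leqnn subnn.
Qed.

(** The product of a Toeplitz matrix with a column is a truncated convolution,
    so left multiplication by [toeplitz u] acts on rows as multiplication by the
    series u. *)
Lemma toeplitz_row_sum u (h : nat -> K) N (i : 'I_N) :
  \sum_(s < N) toeplitz u N i s * h s = \sum_(s < i.+1) u s * h (i - s)%N.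
Proof.
rewrite [RHS](reindex_inj rev_ord_inj) /=.
rewrite (big_ord_widen N (fun s => u (i.+1 - s.+1)%N * h (i - (i.+1 - s.+1))%N)
  (ltn_ord i)) /=.
rewrite [RHS]big_mkcond /=; apply: eq_bigr => s _; rewrite mxE ltnS.
by case: ifP => [lesi|]; rewrite ?mul0r // subSS subKn.
Qed.

(** The coefficient of x^i y^j in u(x) u(y) (xA(x) - yA(y)) / (x - y), the
    fraction being the generating function of A_(i+j). *)
Definition hankel_conv u A i j : K :=
  \sum_(s < i.+1) \sum_(t < j.+1) u s * u t * A (i - s + (j - t))%N.

Lemma toeplitz_hankelE u A N (i j : 'I_N) :
  (toeplitz u N *m (\matrix_(s, t) A (s + t)%N) *m (toeplitz u N)^T) i j
  = hankel_conv u A i j.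
Proof.
rewrite -mulmxA mxE.
pose h s := \sum_(t < j.+1) u t * A (s + (j - t))%N.
transitivity (\sum_(s < N) toeplitz u N i s * h s).
  apply: eq_bigr => s _; congr (_ * _); rewrite mxE.
  rewrite /h -(toeplitz_row_sum u (fun t => A (s + t)%N)).
  by apply: eq_bigr => t _; rewrite !mxE mulrC.
rewrite toeplitz_row_sum; apply: eq_bigr => s _.
by rewrite mulr_sumr; apply: eq_bigr => t _; rewrite mulrA.
Qed.

(** Both sides are the sum of u_s u_t A_(i+j+1-s-t) over s <= i + 1, t <= j + 1
    without the corner s = i + 1, t = j + 1; the separate terms are the row
    s = i + 1 and the column t = j + 1.  In generating functions the relation is
    the result of multiplying by x - y, and it determines [hankel_conv] from its values at j = 0 without
    dividing by x - y. *)
Lemma hankel_convSr u A i j :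
  hankel_conv u A i j.+1 + u i.+1 * (u * A) j
  = hankel_conv u A i.+1 j + u j.+1 * (u * A) i.
Proof.
rewrite /hankel_conv [X in _ = X + _]big_ord_recr /=.
under eq_bigr => s _ do rewrite big_ord_recr /=.
rewrite big_split /= -!addrA; congr (_ + _).
  apply: eq_bigr => s _; apply: eq_bigr => t _; congr (_ * A _).
  by have := ltn_ord s; have := ltn_ord t; lia.
rewrite addrC; congr (_ + _); rewrite mulr_sumr.
  by apply: eq_bigr => t _; rewrite subnn add0n mulrA.
by apply: eq_bigr => t _; rewrite subnn addn0 mulrCA mulrA.
Qed.

Lemma coef_fpsXM V n : (fpsX * V) n = if n is n'.+1 then V n' else 0.
Proof.
rewrite fps_mulE; case: n => [|n]; first by rewrite big_ord1 mul0r.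
rewrite !big_ord_recl /= mul0r add0r mul1r subSS subn0.
by rewrite big1 ?addr0 // => i _; rewrite mul0r.
Qed.

Lemma coef_fpsXnM k V n :
  (fpsX ^+ k * V) n = if (k <= n)%N then V (n - k)%N else 0.
Proof.
elim: k n => [|k IHk] n; first by rewrite mul1r subn0.
by rewrite exprS -mulrA coef_fpsXM; case: n => [|n] //; rewrite IHk.
Qed.

Lemma coef_fpsXn k n : (fpsX ^+ k : fps K) n = (n == k)%:R.
Proof.
rewrite -[fpsX ^+ k]mulr1 coef_fpsXnM /=.
by case: (ltngtP k n) => [ltkn|//|->]; rewrite ?subnn // subn_eq0 leqNgt ltkn.
Qed.

Lemma coef_one n : (1 : fps K) n = (n == 0)%N%:R.
Proof. by rewrite -(coef_fpsXn 0). Qed.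

(** With u = 1 - x^(k+2) V and u W = x^k, the generating function of
    [hankel_conv] is (x^(k+1) u(y) - y^(k+1) u(x)) / (x - y), which splits as
    (x^(k+1) - y^(k+1)) / (x - y) + (xy)^(k+1) (xV(x) - yV(y)) / (x - y): the
    antidiagonal i + j = k and a Hankel array of V shifted by k + 1. *)
Lemma hankel_conv_quotient k V W i j :
  W * (1 - fpsX ^+ k.+2 * V) = fpsX ^+ k ->
  hankel_conv (1 - fpsX ^+ k.+2 * V) W i j
  = ((i + j)%N == k)%:R
    + if (k < i)%N && (k < j)%N then V (i + j - k.+1.*2)%N else 0.
Proof.
set u := 1 - _ => WE.
have uE n : u n = (n == 0)%N%:R - if (k.+2 <= n)%N then V (n - k.+2)%N else 0.
  by rewrite -coef_fpsXnM -coef_one.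
have uWE n : (u * W) n = (n == k)%:R by rewrite mulrC WE coef_fpsXn.
elim: j i => [|j IHj] i.
  transitivity (u 0%N * (u * W) i).
    rewrite /hankel_conv fps_mulE mulr_sumr; apply: eq_bigr => s _.
    by rewrite big_ord1 mulrCA mulrA addn0.
  by rewrite uE uWE /= subr0 mul1r addn0 andbF addr0.
(* The right-hand side obeys the recurrence of [hankel_convSr]; this is a case
   analysis on the positions of i and j relative to k. *)
apply: (addIr (u i.+1 * (u * W) j)); rewrite hankel_convSr IHj !uWE !uE /=.
rewrite addnS addSn !ltnS !sub0r -addrA -[RHS]addrA; congr (_ + _).
case: (ltngtP i k) => ik; case: (ltngtP j k) => jk /=;
  rewrite ?mulr1 ?mulr0 ?addr0 ?add0r ?oppr0 //; try by lia.
  by apply/esym/eqP; rewrite subr_eq0; apply/eqP; congr (V _); lia.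
by apply/eqP; rewrite subr_eq0; apply/eqP; congr (V _); lia.
Qed.

(** Multiplying the Hankel matrix of W on both sides by unipotent Toeplitz
    matrices of 1 - x^(k+2) V keeps the determinant and makes the matrix block
    diagonal, with an antidiagonal block and the Hankel matrix of V. *)
Lemma hankel_quotient k V W M :
  W * (1 - fpsX ^+ k.+2 * V) = fpsX ^+ k ->
  hankel W (k.+1 + M) = (-1) ^+ 'C(k.+1, 2) * hankel V M.
Proof.
move=> WE; set u := 1 - fpsX ^+ k.+2 * V in WE.
have u0 : u 0%N = 1.
  have -> : u 0%N = (1 : fps K) 0%N - (fpsX ^+ k.+2 * V) 0%N by [].
  by rewrite coef_one coef_fpsXnM subr0.
pose H := \matrix_(i < k.+1 + M, j < k.+1 + M) W (i + j)%N.
transitivity (\det (toeplitz u (k.+1 + M) *m H *m (toeplitz u (k.+1 + M))^T)).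
  by rewrite !det_mulmx det_tr det_toeplitz // mul1r mulr1.
have -> : toeplitz u (k.+1 + M) *m H *m (toeplitz u (k.+1 + M))^T
        = block_mx (antidiag_mx k) 0 0 (\matrix_(i, j) V (i + j)%N).
  apply/matrixP => i j; rewrite toeplitz_hankelE hankel_conv_quotient // mxE.
  case: splitP => [i' iE|i' iE]; rewrite mxE;
  case: splitP => [j' jE|j' jE]; rewrite !mxE iE jE.
  - by rewrite [(k < i')%N](_ : _ = false) ?addr0 //; have := ltn_ord i'; lia.
  - by have := ltn_ord i'; case: eqP; case: ifP; rewrite ?addr0 //; lia.
  - by have := ltn_ord j'; case: eqP; case: ifP; rewrite ?addr0 //; lia.
  rewrite !leq_addr [(_ == _)](_ : _ = false) ?add0r /=; last by lia.
  by congr (V _); lia.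
by rewrite det_ublock det_antidiag.
Qed.

(** The first row of the matrix is zero. *)
Lemma hankel_eq0 k W N : (0 < N <= k)%N ->
  (forall i, (i < k)%N -> W i = 0) -> hankel W N = 0.
Proof.
case: N => // N /andP[_ leNk] W0.
rewrite /hankel (expand_det_row _ ord0) big1 // => j _.
by rewrite mxE W0 ?mul0r // add0n (leq_trans (ltn_ord j)).
Qed.

Lemma hankel_scale c A N : hankel (fpsC c * A) N = c ^+ N * hankel A N.
Proof.
rewrite -detZ; congr (\det _); apply/matrixP => i j; rewrite !mxE fps_mulE.
rewrite big_ord_recl subn0 big1 ?addr0 // => s _.
by rewrite mul0r.
Qed.

End HankelReduction.

(** * Periodicity for the quadratic series *)

(** The exponent l of the theorem is written [l.+2] here, so [l.+1] stands for
    its l - 1 and [l] for its l - 2. *)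
Section QuadraticSeries.
Variables (K : fieldType) (m l : nat) (a b : K) (F : fps K).
Hypothesis FE : F = fpsX ^+ m /
  (1 - fpsC a * fpsX ^+ (m + l.+2) - fpsC b * fpsX ^+ l.+2 * F).

Let q := (m + l.+2)%N.
Let c := a + b.
Let sgn := (-1) ^+ ('C(m.+1, 2) + 'C(l.+1, 2)) : K.

(** The two continued fraction steps that lead from F back to b F; the factors
    x^m of F and x^l of W make the short determinants vanish. *)
Lemma fps_two_step : exists G W : fps K,
  [/\ F * (1 - fpsX ^+ m.+2 * (fpsC c * W)) = fpsX ^+ m,
      W * (1 - fpsX ^+ l.+2 * (fpsC b * F)) = fpsX ^+ l,
      F = fpsX ^+ m * G & exists H, W = fpsX ^+ l * H].
Proof.
have qE : fpsX ^+ q = fpsX ^+ m * fpsX ^+ l * fpsX ^+ 2 :> fps K.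
  by rewrite -!exprD; congr (_ ^+ _); rewrite /q; lia.
have mE : fpsX ^+ m.+2 = fpsX ^+ m * fpsX ^+ 2 :> fps K.
  by rewrite -exprD addn2.
have lE : fpsX ^+ l.+2 = fpsX ^+ l * fpsX ^+ 2 :> fps K.
  by rewrite -exprD addn2.
have [G FG GD] : exists2 G, F = fpsX ^+ m * G
    & G * (1 - fpsX ^+ q * (fpsC a + fpsC b * G)) = 1.
  have FD := FE; set D := 1 - _ - _ in FD.
  have DU : D \is a GRing.unit by apply: fps_denom_unit; rewrite ?addnS.
  exists D^-1 => //; rewrite -[RHS](mulVr DU); congr (_ * _).
  by rewrite [in RHS]/D [in RHS]FD -/q qE lE; move: (D^-1) => G; ring.
pose E := 1 - fpsC b * fpsX ^+ q * G.
have EU : E \is a GRing.unit.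
  by rewrite /E -[1]subr0 -(mul0r (fpsX ^+ q)) fps_denom_unit // /q addnS.
pose H := E^-1; have HE : H * E = 1 by apply: mulVr.
have cE : fpsC c = fpsC a + fpsC b.
  by apply/fpsP => n /=; case: eqP; rewrite ?addr0.
(* The key identity: g E = c for g = a + b G, hence g = c H. *)
have gE : fpsC a + fpsC b * G = fpsC c * H.
  have cGE : fpsC c = (fpsC a + fpsC b * G) * E.
    by rewrite cE -{1}[fpsC b]mulr1 -{1}GD /E; ring.
  by rewrite cGE -mulrA (mulrC E) HE mulr1.
exists G, (fpsX ^+ l * H); split=> //; last by exists H.
- rewrite FG -[RHS]mulr1 -[in RHS]GD gE mE qE; ring.
- by rewrite -[RHS]mulr1 -[in RHS]HE FG lE /E qE; ring.
Qed.

Lemma hankel_low N : (0 < N <= m)%N -> hankel F N = 0.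
Proof.
move=> Nm; have [G [W [_ _ FG _]]] := fps_two_step.
by apply: hankel_eq0 Nm _ => i lti; rewrite FG coef_fpsXnM leqNgt lti.
Qed.

Lemma hankel_firstS : hankel F m.+1 = (-1) ^+ 'C(m.+1, 2).
Proof.
have [_ [W [FW _ _ _]]] := fps_two_step.
by have := hankel_quotient 0 FW; rewrite addn0 hankel0 mulr1.
Qed.

(** After the first step what remains is a determinant of W of size between 1
    and l, which vanishes because W starts at x^l. *)
Lemma hankel_gap N : (m.+1 < N < q)%N -> hankel F N = 0.
Proof.
move=> Nq; have [_ [W [FW _ _ [H WH]]]] := fps_two_step.
have -> : N = (m.+1 + (N - m.+1))%N by lia.
rewrite (hankel_quotient _ FW) hankel_scale (@hankel_eq0 _ l W) ?mulr0 //.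
  by move: Nq; rewrite /q; lia.
by move=> i lti; rewrite WH coef_fpsXnM leqNgt lti.
Qed.

Lemma hankel_periodD N :
  hankel F (q + N) = sgn * c ^+ (l.+1 + N) * b ^+ N * hankel F N.
Proof.
have [_ [W [FW WF _ _]]] := fps_two_step.
have -> : (q + N = m.+1 + (l.+1 + N))%N by rewrite /q; lia.
rewrite (hankel_quotient _ FW) hankel_scale (hankel_quotient _ WF) hankel_scale.
rewrite /sgn; move: 'C(m.+1, 2) 'C(l.+1, 2) (-1) => s t e.
by rewrite !exprD; ring.
Qed.

Lemma hankel_period n :
  hankel F (q * n) = (-1) ^+ ('C(m.+1, 2) * n + 'C(l.+1, 2) * n)
    * c ^+ (q * 'C(n, 2) + l.+1 * n) * b ^+ (q * 'C(n, 2)).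
Proof.
elim: n => [|n IHn].
  by rewrite !muln0 hankel0 !mulr1.
rewrite mulnS hankel_periodD IHn /sgn.
move: 'C(m.+1, 2) 'C(l.+1, 2) (-1) => s t e.
rewrite binS bin1 !mulnDr !mulnS; move: 'C(n, 2) => p.
by rewrite !exprD; ring.
Qed.

Lemma hankel_period_first n :
  hankel F (q * n + m + 1) = (-1) ^+ ('C(m.+1, 2) * n.+1 + 'C(l.+1, 2) * n)
    * c ^+ (q * 'C(n.+1, 2)) * b ^+ (q * 'C(n.+1, 2) - l.+1 * n).
Proof.
elim: n => [|n IHn].
  by rewrite !muln0 muln1 addn0 add0n addn1 hankel_firstS !mulr1.
have -> : (q * n.+1 + m + 1 = q + (q * n + m + 1))%N by rewrite mulnS !addnA.
(* The truncated subtraction in the exponent of b is a true one. *)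
have le_exp : (l.+1 * n <= q * 'C(n.+1, 2))%N.
  case: n {IHn} => [|n]; first by rewrite muln0.
  by rewrite leq_mul //; [rewrite /q; lia | rewrite (binS n.+1) bin1 leq_addl].
have bE : (q * 'C(n.+2, 2) - l.+1 * n.+1
           = q * n + m + 1 + (q * 'C(n.+1, 2) - l.+1 * n))%N.
  by rewrite (binS n.+1) bin1 mulnDr !mulnS; move: le_exp; rewrite /q; lia.
have cE : (q * 'C(n.+2, 2) = l.+1 + (q * n + m + 1) + q * 'C(n.+1, 2))%N.
  by rewrite (binS n.+1) bin1 mulnDr mulnS /q; lia.
rewrite hankel_periodD IHn bE {bE le_exp}.
rewrite [(q * 'C(n.+2, 2))%N]cE {cE} /sgn.
move: 'C(m.+1, 2) 'C(l.+1, 2) 'C(n.+1, 2) (-1) => s t p e.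
by rewrite !mulnS !exprD; ring.
Qed.

Lemma hankel_periodic_eq0 N :
  (forall n, N <> q * n /\ N <> q * n + m + 1)%N -> hankel F N = 0.
Proof.
elim/ltn_ind: N => N IHN Nq.
have [ltNq|leqN] := ltnP N q.
  have [N0 Nm1] := Nq 0%N; rewrite muln0 in N0 Nm1.
  have [ltNm|lemN] := leqP N m; [apply: hankel_low | apply: hankel_gap]; lia.
have NE : N = (q + (N - q))%N by lia.
rewrite NE hankel_periodD IHN ?mulr0 //; first by move: leqN; rewrite /q; lia.
move=> n; have [N1 N2] := Nq n.+1; rewrite mulnS in N1 N2.
by split=> E; [apply: N1 | apply: N2]; lia.
Qed.

End QuadraticSeries.

Local Open Scope complex_scope.

Theorem theorem20 (R : realType) (m l q : nat) (a b : R[i]) (F : fps R[i])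
    (hq : (m + l)%N = q) (hl : (2 <= l)%N)
    (hF : F = fpsX ^+ m / (1 - fpsC a * fpsX ^+ q - fpsC b * fpsX ^+ l * F)) :
  (forall n : nat,
     hankel F ((l + m) * n) =
       (-1) ^+ ('C(m.+1, 2) * n + 'C(l - 1, 2) * n)
       * (a + b) ^+ (((l + m) * (n - 1) * n) %/ 2 + (l - 1) * n)
       * b ^+ (((l + m) * (n - 1) * n) %/ 2)) /\
  (forall n : nat,
     hankel F ((l + m) * n + m + 1) =
       (-1) ^+ ('C(m.+1, 2) * n.+1 + 'C(l - 1, 2) * n)
       * (a + b) ^+ (((l + m) * n.+1 * n) %/ 2)
       * b ^+ (((l + m) * n.+1 * n) %/ 2 - (l - 1) * n)) /\
  (forall N : nat,
     (forall n : nat, N <> ((l + m) * n)%N /\ N <> ((l + m) * n + m + 1)%N) ->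
     hankel F N = 0).
Proof.
case: l hl hq hF => [|[|l]] // _ <- hF; rewrite subSS subn0 [(l.+2 + m)%N]addnC.
have halfE p n : ((p * n * n.-1) %/ 2 = p * 'C(n, 2))%N.
  have := mul_bin_diag n 1; rewrite bin1 -mulnA => ->.
  by rewrite mulnCA mulKn.
split=> [n|]; last split=> [n|N].
- by rewrite subn1 [(_ * n.-1 * n)%N]mulnAC halfE (hankel_period hF).
- by rewrite (halfE _ n.+1) (hankel_period_first hF).
exact: hankel_periodic_eq0 hF N.
Qed.
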